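(* For every integer $d\ge 1$, $\mathrm{rc}(\{0,1\}^d)=d+1$.
   Context: For $X\subseteq\mathbb{Z}^d$, a polyhedron $R\subseteq\mathbb{R}^d$ is called a relaxation for $X$ if $R\cap\mathbb{Z}^d=\mathrm{conv}(X)\cap\mathbb{Z}^d$. The relaxation complexity $\mathrm{rc}(X)$ is the smallest number of facets of any relaxation for $X$ (relaxations may be defined by inequalities with arbitrary real coefficients). *)

(* Defs.v *)
From mathcomp Require Import all_boot all_order all_algebra.
From mathcomp Require Import boolp classical_sets functions cardinality.
From mathcomp Require Import reals convex.

Set Implicit Arguments.
Unset Strict Implicit.
Unset Printing Implicit Defensive.

Import Order.TTheory GRing.Theory Num.Theory.
Local Open Scope classical_set_scope.
Local Open Scope ring_scope.

Definition conv (R : realType) (d : nat) (S : set 'cV[R]_d) : set 'cV[R]_d :=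
  smallest (@convex_set R 'cV[R]_d) S.

Definition polyhedron (R : realType) (d : nat) (P : set 'cV[R]_d) : Prop :=
  exists (m : nat) (A : 'M[R]_(m, d)) (b : 'cV[R]_m),
    P = [set x : 'cV[R]_d | forall i, (A *m x) i 0 <= b i 0].

Definition affinely_independent (R : realType) (d k : nat)
    (p : 'I_k -> 'cV[R]_d) : Prop :=
  forall c : 'I_k -> R,
    \sum_i c i = 0 -> \sum_i c i *: p i = 0 -> forall i, c i = 0.

Lemma affinely_independent_leq (R : realType) (d k : nat)
    (p : 'I_k -> 'cV[R]_d) : affinely_independent p -> (k <= d.+1)%N.
Proof.
move=> pind; pose M : 'M[R]_(k, 1 + d) := row_mx (const_mx 1) (\matrix_i (p i)^T).
suff : row_free M by move=> /eqP <-; exact: rank_leq_col.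
apply: inj_row_free => c; rewrite mul_mx_row -[0 in RHS]row_mx0.
move=> /eq_row_mx [c1 cp]; apply/rowP => i; rewrite mxE.
apply: (pind (fun j => c 0 j)).
  have /rowP/(_ 0) := c1; rewrite !mxE => e; rewrite -[RHS]e.
  by apply: eq_bigr => j _; rewrite mxE mulr1.
apply/colP => l; have /rowP/(_ l) := cp; rewrite !mxE => e; rewrite -[RHS]e.
by rewrite summxE; apply: eq_bigr => j _; rewrite !mxE.
Qed.

(* The largest number of affinely independent points of S, minus one; by
   affinely_independent_leq, considering at most d + 1 points is enough.
   In particular the dimension of the empty set is -1. *)
Definition affdim (R : realType) (d : nat) (S : set 'cV[R]_d) : int :=
  (\max_(k < d.+2 | `[< exists p : 'I_k -> 'cV[R]_d,
      (forall i, S (p i)) /\ affinely_independent p >]) k)%N%:Z - 1.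

(* The choice a = 0 is allowed, so that P and the empty set are faces of P. *)
Definition face (R : realType) (d : nat) (P F : set 'cV[R]_d) : Prop :=
  exists (a : 'rV[R]_d) (beta : R),
    (forall x, P x -> (a *m x) 0 0 <= beta) /\
    F = P `&` [set x : 'cV[R]_d | (a *m x) 0 0 = beta].

Definition facet (R : realType) (d : nat) (P F : set 'cV[R]_d) : Prop :=
  face P F /\ affdim F = affdim P - 1.

Definition embZ (R : realType) (d : nat) (x : 'cV[int]_d) : 'cV[R]_d :=
  map_mx intr x.

Definition Zlattice (R : realType) (d : nat) : set 'cV[R]_d := range (@embZ R d).
Arguments Zlattice : clear implicits.

Definition relaxation (R : realType) (d : nat) (X : set 'cV[int]_d)
    (P : set 'cV[R]_d) : Prop :=
  polyhedron P /\
  P `&` Zlattice R d = conv (@embZ R d @` X) `&` Zlattice R d.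

Definition has_relaxation_with (R : realType) (d : nat) (X : set 'cV[int]_d)
    (n : nat) : Prop :=
  exists P : set 'cV[R]_d, relaxation X P /\ ([set F | facet P F] #= `I_n)%card.

(* None when X has no relaxation. *)
Definition rc (R : realType) (d : nat) (X : set 'cV[int]_d) : option nat :=
  if pselect (exists n, `[< has_relaxation_with R X n >]) is left h
  then Some (ex_minn h) else None.

Definition cube (d : nat) : set 'cV[int]_d :=
  [set x : 'cV[int]_d | forall i, x i 0 = 0 \/ x i 0 = 1].
Arguments cube : clear implicits.

(* Main.v *)
Require Import Defs.
From mathcomp Require Import all_boot all_order all_algebra.
From mathcomp Require Import boolp classical_sets cardinality.
From mathcomp Require Import interval_inference reals convex.
From mathcomp Require Import zify ring lra.

(* Upper bound: the integer points of the simplex given by the d + 1 inequalities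
   [sum_j 2^-j x_j >= 0] and [x_k <= 1 + sum_(j > k) 2^-j x_j] are the 0/1
   vectors: downward induction on [k] gives [x_k <= 1], then upward induction
   gives [sum_(j >= k) 2^-j x_j >= 0] and [x_k >= 0].

   Lower bound: a system [A x <= b] with at most d rows has a nonzero [u] with
   [A u <= 0]; a relaxation of the cube contains the box [0,1]^d, hence all its
   translates along [u], each of which contains an integer point.

   Rows become facets because the center of the box is interior: the facets of an
   irredundant system with an interior point correspond to its rows. *)

Set Implicit Arguments.
Unset Strict Implicit.
Unset Printing Implicit Defensive.

Import Order.TTheory GRing.Theory Num.Theory.
Local Open Scope classical_set_scope.
Local Open Scope ring_scope.

(** * Affine independence and hyperplanes in homogeneous coordinates *)

(** Row [i] is the point [p i] preceded by a coordinate 1, so affine dependences among the points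
    are linear dependences among the rows. *)
Definition homog (R : realType) (d k : nat) (p : 'I_k -> 'cV[R]_d) :
    'M[R]_(k, 1 + d) :=
  row_mx (const_mx 1) (\matrix_i (p i)^T).

Lemma homog_row_free (R : realType) (d k : nat) (p : 'I_k -> 'cV[R]_d) :
  affinely_independent p -> row_free (homog p).
Proof.
move=> pind; apply: inj_row_free => c; rewrite mul_mx_row -[0 in RHS]row_mx0.
move=> /eq_row_mx [c1 cp]; apply/rowP => i; rewrite mxE.
apply: (pind (fun j => c 0 j)).
  have /rowP/(_ 0) := c1; rewrite !mxE => e; rewrite -[RHS]e.
  by apply: eq_bigr => j _; rewrite mxE mulr1.
apply/colP => l; have /rowP/(_ l) := cp; rewrite !mxE => e; rewrite -[RHS]e.
by rewrite summxE; apply: eq_bigr => j _; rewrite !mxE.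
Qed.

Lemma homog_mul_hyperplane (R : realType) (d k : nat) (p : 'I_k -> 'cV[R]_d)
    (a : 'rV[R]_d) (beta : R) :
  (forall i, (a *m p i) 0 0 = beta) ->
  homog p *m (row_mx (- beta)%:M a)^T = 0.
Proof.
move=> pa; rewrite tr_row_mx mul_row_col; apply/colP => i.
rewrite tr_scalar_mx mul_mx_scalar !mxE -(pa i) mulr1 !mxE.
apply/eqP; rewrite addrC subr_eq0; apply/eqP.
by apply: eq_bigr => j _; rewrite !mxE mulrC.
Qed.

(** The nonzero vector [(- beta, a)] is killed by [homog p], which has rank [k] and [1 + d]
    columns. *)
Lemma affinely_independent_hyperplane (R : realType) (d k : nat)
    (p : 'I_k -> 'cV[R]_d) (a : 'rV[R]_d) (beta : R) :
  affinely_independent p -> a != 0 -> (forall i, (a *m p i) 0 0 = beta) ->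
  (k <= d)%N.
Proof.
move=> /homog_row_free /eqP kE a0 /homog_mul_hyperplane /mulmx0_rank_max.
rewrite kE mxrank_tr; suff : (0 < \rank (row_mx (- beta)%:M a))%N by lia.
rewrite lt0n mxrank_eq0; apply: contra_neq a0 => e.
by rewrite -[a](row_mxKr (- beta)%:M) e linear0.
Qed.

(** With [d] independent points, [homog p] has rank [d], so its kernel is a line; it contains
    [(- beta, a)], which is nonzero, and [(- beta', a')]. *)
Lemma hyperplane_unique (R : realType) (d : nat) (p : 'I_d -> 'cV[R]_d)
    (a a' : 'rV[R]_d) (beta beta' : R) :
  affinely_independent p -> a != 0 ->
  (forall i, (a *m p i) 0 0 = beta) -> (forall i, (a' *m p i) 0 0 = beta') ->
  exists t : R, a' = t *: a /\ beta' = t * beta.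
Proof.
move=> /homog_row_free /eqP kE a0.
move=> /homog_mul_hyperplane pa /homog_mul_hyperplane pa'.
set u := row_mx _ a in pa; set u' := row_mx _ a' in pa'.
have u0 : u != 0.
  apply: contra_neq a0 => e.
  by rewrite -[a](row_mxKr (- beta)%:M) -/u e linear0.
have N1 : (\rank (col_mx u u') <= 1)%N.
  have /mulmx0_rank_max : homog p *m (col_mx u u')^T = 0.
    by rewrite tr_col_mx mul_mx_row pa pa' row_mx0.
  by rewrite kE mxrank_tr; lia.
have uN : (u <= col_mx u u')%MS by rewrite -addsmxE addsmxSl.
have Nu : (col_mx u u' <= u)%MS.
  rewrite -(mxrank_leqif_sup uN) eqn_leq (mxrankS uN) /=.
  by apply: leq_trans N1 _; rewrite lt0n mxrank_eq0.
have /sub_rVP [t tE] : (u' <= u)%MS.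
  by apply: submx_trans Nu; rewrite -addsmxE addsmxSr.
exists t; move: tE; rewrite /u /u' scale_row_mx => /eq_row_mx [e1 e2].
split=> //; have /matrixP/(_ 0 0) := e1; rewrite !mxE !mulr1n.
by rewrite mulrN => /oppr_inj.
Qed.

(** * Affine dimension *)

Lemma affdim_ge (R : realType) (d k : nat) (S : set 'cV[R]_d)
    (p : 'I_k -> 'cV[R]_d) :
  (forall i, S (p i)) -> affinely_independent p -> k%:Z - 1 <= affdim S.
Proof.
move=> pS pind; rewrite lerD2r lez_nat.
have kd : (k < d.+2)%N by rewrite ltnS (affinely_independent_leq pind).
rewrite -[k in (k <= _)%N]/(nat_of_ord (Ordinal kd)).
by apply: leq_bigmax_cond; apply/asboolP; exists p.
Qed.

Lemma affdim_attained (R : realType) (d : nat) (S : set 'cV[R]_d) :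
  exists (k : nat) (p : 'I_k -> 'cV[R]_d),
    [/\ forall i, S (p i), affinely_independent p & affdim S = k%:Z - 1].
Proof.
pose P (k : 'I_d.+2) := `[< exists p : 'I_k -> 'cV[R]_d,
  (forall i, S (p i)) /\ affinely_independent p >].
have [|k kP kE] := @eq_bigmax_cond _ P (@nat_of_ord d.+2).
  (* The empty family is affinely independent and lies in every set, so the maximum is over a
     nonempty index set. *)
  apply/card_gt0P; exists ord0; apply/asboolP.
  by exists (fun=> 0); split=> [[]|c _ _ []].
move: kP => /asboolP [p [pS pind]]; exists k, p; split=> //.
by rewrite -kE.
Qed.

Lemma affdim_le (R : realType) (d : nat) (S : set 'cV[R]_d) :
  affdim S <= d%:Z.
Proof.
have [k [p [_ /affinely_independent_leq kd ->]]] := affdim_attained S.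
lia.
Qed.

Lemma affdim_le_hyperplane (R : realType) (d : nat) (S : set 'cV[R]_d)
    (a : 'rV[R]_d) (beta : R) :
  a != 0 -> S `<=` [set x | (a *m x) 0 0 = beta] -> affdim S <= d%:Z - 1.
Proof.
move=> a0 Sa; have [k [p [pS pind ->]]] := affdim_attained S.
have := affinely_independent_hyperplane pind a0 (fun i => Sa _ (pS i)); lia.
Qed.

(** * Small displacements of a point *)

Definition spread (R : realType) (d k : nat) (w : 'cV[R]_d) (e : R)
    (V : 'M[R]_(k, d)) (l : 'I_k.+1) : 'cV[R]_d :=
  if unlift ord0 l is Some j then w + e *: (row j V)^T else w.

Lemma spread_affinely_independent (R : realType) (d k : nat) (w : 'cV[R]_d)
    (e : R) (V : 'M[R]_(k, d)) :
  e != 0 -> row_free V -> affinely_independent (spread w e V).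
Proof.
move=> e0 Vfree c; rewrite !big_ord_recl /spread unlift_none => c0.
under eq_bigr do rewrite liftK scalerDr scalerA mulrC -scalerA.
rewrite big_split /= -scaler_suml addrA -scalerDl c0 scale0r add0r.
rewrite -scaler_sumr => /eqP; rewrite scaler_eq0 (negPf e0) /= => /eqP cV.
have cl : forall j, c (lift ord0 j) = 0.
  move=> j; have : \row_j c (lift ord0 j) *m V = 0.
    apply: trmx_inj; rewrite linear0 -cV mulmx_sum_row linear_sum /=.
    by apply: eq_bigr => i _; rewrite linearZ /= mxE.
  by move=> /eqP; rewrite mulmx_free_eq0 // => /eqP/rowP/(_ j); rewrite !mxE.
move=> i; case: (unliftP ord0 i) => [j ->//|->].
by move: c0; rewrite big1 ?addr0.
Qed.

(** Here [u i] is the slack of constraint [i] and [v i j] its growth along direction [j]; finitely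
    many constraints and directions admit a common step length. *)
Lemma small_step (R : realFieldType) (I J : finType) (u : I -> R)
    (v : I -> J -> R) :
  (forall i, 0 <= u i) -> (forall i j, u i = 0 -> v i j <= 0) ->
  exists2 e, 0 < e & forall i j, e * v i j <= u i.
Proof.
(* Division by zero yields 0, so tight constraints add nothing to [s]; for the others [s] bounds
   every ratio of growth to slack. *)
move=> u0 v0; pose s := \sum_i \sum_j `|v i j| / u i.
have s0 i j : 0 <= `|v i j| / u i by rewrite mulr_ge0 ?invr_ge0.
have s_ge0 : 0 <= s by do 2!apply: sumr_ge0 => ? _.
exists (1 + s)^-1 => [|i j]; first by rewrite invr_gt0 ltr_pwDl.
have [ui0|ui0] := eqVneq (u i) 0.
  by rewrite ui0 pmulr_rle0 ?v0// invr_gt0 ltr_pwDl.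
have ui : 0 < u i by rewrite lt_def ui0 u0.
rewrite mulrC ler_pdivrMr ?ltr_pwDl// mulrC -ler_pdivrMr//.
have : `|v i j| / u i <= s.
  rewrite /s (bigD1 i)//= (bigD1 j)//= -addrA lerDl.
  by rewrite addr_ge0 ?sumr_ge0// => *; rewrite sumr_ge0.
have : v i j / u i <= `|v i j| / u i by rewrite ler_pM2r ?invr_gt0 ?ler_norm.
lra.
Qed.

(** * Linear systems, irredundancy and points near a solution *)

Definition solutions (R : realType) (d m : nat) (A : 'M[R]_(m, d))
    (b : 'cV[R]_m) : set 'cV[R]_d :=
  [set x | forall i, (A *m x) i 0 <= b i 0].

Definition irredundant (R : realType) (d m : nat) (A : 'M[R]_(m, d))
    (b : 'cV[R]_m) : Prop :=
  forall i, exists y : 'cV[R]_d, b i 0 < (A *m y) i 0 /\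
    forall j, j != i -> (A *m y) j 0 <= b j 0.

Definition row_face (R : realType) (d m : nat) (A : 'M[R]_(m, d))
    (b : 'cV[R]_m) (i : 'I_m) : set 'cV[R]_d :=
  solutions A b `&` [set x | (row i A *m x) 0 0 = b i 0].

Lemma row_mulE (R : realType) (d m : nat) (A : 'M[R]_(m, d)) (x : 'cV[R]_d)
    (i : 'I_m) : (row i A *m x) 0 0 = (A *m x) i 0.
Proof. by rewrite -row_mul mxE. Qed.

(** Induction on the number of rows: if no point violates row [i] alone, deleting that row leaves
    the solution set unchanged. *)
Lemma irredundant_exists (R : realType) (d m : nat) (A : 'M[R]_(m, d))
    (b : 'cV[R]_m) :
  exists (m' : nat) (A' : 'M[R]_(m', d)) (b' : 'cV[R]_m'),
    [/\ (m' <= m)%N, solutions A' b' = solutions A b & irredundant A' b'].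
Proof.
elim: m A b => [|m IH] A b; first by exists 0, A, b; split=> // -[].
have [irr|] := pselect (irredundant A b); first by exists m.+1, A, b.
move=> /existsNP[i /forallNP nirr].
have [m' [A' [b' [m'm sE irr]]]] := IH (row' i A) (row' i b).
exists m', A', b'; split=> //; first exact: leqW.
have rE (x : 'cV[R]_d) j : (row' i A *m x) j 0 = (A *m x) (lift i j) 0.
  by rewrite !mxE; apply: eq_bigr => k _; rewrite mxE.
rewrite sE; apply/seteqP; split=> x xs j; last by rewrite rE [leRHS]mxE; apply: xs.
have xj k : k != i -> (A *m x) k 0 <= b k 0.
  rewrite eq_sym => /unlift_some[l -> _].
  by have := xs l; rewrite rE [leRHS]mxE.
have [->|/xj//] := eqVneq j i.
by rewrite leNgt; apply/negP => bx; case: (nirr x).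
Qed.

(** The rows of [V] are directions orthogonal to every constraint tight at [w]. A short move along
    them keeps tight constraints tight and respects the slack ones. *)
Lemma solutions_spread (R : realType) (d m k : nat) (A : 'M[R]_(m, d))
    (b : 'cV[R]_m) (w : 'cV[R]_d) (V : 'M[R]_(k, d)) :
  solutions A b w -> row_free V ->
  (forall i, (A *m w) i 0 = b i 0 -> V *m (row i A)^T = 0) ->
  exists p : 'I_k.+1 -> 'cV[R]_d, affinely_independent p /\
    forall l, solutions A b (p l) /\
      forall i, (A *m w) i 0 = b i 0 -> (A *m p l) i 0 = b i 0.
Proof.
move=> wP Vfree VA.
have VAE i j : (V *m (row i A)^T) j 0 = (A *m (row j V)^T) i 0.
  by rewrite !mxE; apply: eq_bigr => l _; rewrite !mxE mulrC.
have [|i j /eqP|e e0 step] := @small_step R _ _ (fun i => b i 0 - (A *m w) i 0)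
    (fun i j => (A *m (row j V)^T) i 0).
- by move=> i; rewrite subr_ge0.
- by rewrite subr_eq0 => /eqP/esym/VA/colP/(_ j); rewrite VAE [RHS]mxE => ->.
exists (spread w e V); split.
  by apply: spread_affinely_independent => //; rewrite gt_eqF.
move=> l; rewrite /spread; case: (unlift ord0 l) => [j|//].
split=> i.
  rewrite mulmxDr -scalemxAr mxE [X in _ + X]mxE.
  by have := step i j; rewrite lerBrDl.
move=> wi; rewrite mulmxDr -scalemxAr mxE [X in _ + X]mxE wi.
by have /colP/(_ j) := VA _ wi; rewrite VAE [RHS]mxE => ->; rewrite mulr0 addr0.
Qed.

(** Nothing is tight at [z], so all [d] coordinate directions are available. *)
Lemma affdim_solutions (R : realType) (d m : nat) (A : 'M[R]_(m, d))
    (b : 'cV[R]_m) (z : 'cV[R]_d) :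
  (forall i, (A *m z) i 0 < b i 0) -> affdim (solutions A b) = d%:Z.
Proof.
move=> zb; have [||i zi|p [pind pP]] := @solutions_spread R d m d A b z 1%:M.
- by move=> i; apply: ltW.
- by rewrite row_free_unit unitmx1.
- by have := zb i; rewrite zi ltxx.
apply/eqP; rewrite eq_le affdim_le/=.
have := affdim_ge (fun l => (pP l).1) pind; lia.
Qed.

(* The point where the segment from [z] to [y] crosses the [i]-th hyperplane. *)
Lemma irredundant_tight (R : realType) (d m : nat) (A : 'M[R]_(m, d))
    (b : 'cV[R]_m) (z : 'cV[R]_d) (i : 'I_m) :
  irredundant A b -> (forall i, (A *m z) i 0 < b i 0) ->
  exists w : 'cV[R]_d, (A *m w) i 0 = b i 0 /\
    forall j, j != i -> (A *m w) j 0 < b j 0.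
Proof.
move=> /(_ i)[y [yi yj]] zb; have zi := zb i.
pose t := (b i 0 - (A *m z) i 0) / ((A *m y) i 0 - (A *m z) i 0).
have yz : 0 < (A *m y) i 0 - (A *m z) i 0 by lra.
have t0 : 0 < t by rewrite divr_gt0// subr_gt0.
have t1 : t < 1 by rewrite ltr_pdivrMr// mul1r; lra.
have wE j : (A *m ((1 - t) *: z + t *: y)) j 0 =
    (1 - t) * (A *m z) j 0 + t * (A *m y) j 0.
  by rewrite mulmxDr -!scalemxAr mxE [X in X + _]mxE [X in _ + X]mxE.
exists ((1 - t) *: z + t *: y); split=> [|j ji]; rewrite wE.
  by rewrite /t; field; rewrite gt_eqF.
have : 0 < (1 - t) * (b j 0 - (A *m z) j 0) by rewrite mulr_gt0 ?subr_gt0.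
have : 0 <= t * (b j 0 - (A *m y) j 0).
  by rewrite mulr_ge0 ?subr_ge0 ?yj// ltW.
lra.
Qed.

(** * Correspondence between facets and rows *)

Lemma irredundant_row_neq0 (R : realType) (d m : nat) (A : 'M[R]_(m, d))
    (b : 'cV[R]_m) (z : 'cV[R]_d) (i : 'I_m) :
  irredundant A b -> solutions A b z -> row i A != 0.
Proof.
move=> /(_ i)[y [yi _]] /(_ i) zi; apply/eqP => A0.
move: yi zi; rewrite -(row_mulE A y) -(row_mulE A z) A0 !mul0mx !mxE.
by move=> /lt_le_trans h /h; rewrite ltxx.
Qed.

(** At a point where only row [i] is tight, the admissible directions form the kernel of that row,
    of dimension [d.-1]; the hyperplane gives the matching upper bound. *)
Lemma affdim_row_face (R : realType) (d m : nat) (A : 'M[R]_(m, d))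
    (b : 'cV[R]_m) (z : 'cV[R]_d) (i : 'I_m) :
  irredundant A b -> (forall i, (A *m z) i 0 < b i 0) ->
  affdim (row_face A b i) = d%:Z - 1.
Proof.
move=> irr zb; have [w [wi wj]] := irredundant_tight i irr zb.
have Ai : row i A != 0.
  by apply: (irredundant_row_neq0 i irr (z := z)) => j; apply: ltW.
pose K := kermx (row i A)^T.
have rK : \rank K = d.-1 by rewrite mxrank_ker mxrank_tr rank_rV Ai subn1.
(* Positivity of [d] makes the [d.-1.+1] points obtained below exactly [d] points. *)
have d0 : (0 < d)%N.
  by have := rank_leq_col (row i A); rewrite rank_rV Ai.
have [|||p [pind pP]] := @solutions_spread R d m _ A b w (row_base K).
- by move=> j; have [->|/wj/ltW//] := eqVneq j i; rewrite wi.
- exact: row_base_free.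
- move=> j; have [-> _|/wj] := eqVneq j i; last by move=> + e; rewrite e ltxx.
  by apply/eqP; rewrite -sub_kermx eq_row_base submx_refl.
apply/eqP; rewrite eq_le; apply/andP; split.
  by apply: (@affdim_le_hyperplane _ _ _ (row i A) (b i 0)) => // x [].
have pF l : row_face A b i (p l).
  have [? h] := pP l; split=> //=; rewrite row_mulE; exact: h.
have := affdim_ge pF pind; lia.
Qed.

(** A short step [e] from [z] along [a^T] stays in the solution set and raises the functional by [e]
    times the squared norm of [a], which must then vanish. *)
Lemma valid_tight_interior (R : realType) (d m : nat) (A : 'M[R]_(m, d))
    (b : 'cV[R]_m) (z : 'cV[R]_d) (a : 'rV[R]_d) (beta : R) :
  (forall i, (A *m z) i 0 < b i 0) ->
  (forall x, solutions A b x -> (a *m x) 0 0 <= beta) ->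
  (a *m z) 0 0 = beta -> a = 0.
Proof.
move=> zb aP az.
have [|i j /eqP|e e0 step] := @small_step R _ unit
    (fun i => b i 0 - (A *m z) i 0) (fun i _ => (A *m a^T) i 0).
- by move=> i; rewrite subr_ge0 ltW.
- by rewrite subr_eq0 => /eqP zi; have := zb i; rewrite zi ltxx.
have : solutions A b (z + e *: a^T).
  move=> i; rewrite mulmxDr -scalemxAr mxE [X in _ + X]mxE.
  by have := step i tt; rewrite lerBrDl.
move=> /aP; rewrite mulmxDr -scalemxAr mxE [X in _ + X]mxE az gerDl pmulr_rle0//.
have sq0 j : true -> 0 <= a 0 j * a^T j 0 by rewrite mxE -expr2 sqr_ge0.
rewrite mxE => h; apply/rowP => j; rewrite mxE.
have /psumr_eq0P : \sum_j a 0 j * a^T j 0 = 0.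
  by apply/eqP; rewrite eq_le h sumr_ge0.
move=> /(_ sq0 j isT) /eqP; rewrite mxE mulf_eq0 orbb => /eqP //.
Qed.

(** Take [d] affinely independent points of [F]. If one row is tight at all of them, it defines the
    same hyperplane as [F]; otherwise their centroid is strictly interior, which forces [a = 0]. *)
Lemma facet_row_face (R : realType) (d m : nat) (A : 'M[R]_(m, d))
    (b : 'cV[R]_m) (z : 'cV[R]_d) (F : set 'cV[R]_d) :
  (0 < d)%N -> (forall i, row i A != 0) -> (forall i, (A *m z) i 0 < b i 0) ->
  facet (solutions A b) F -> exists i, F = row_face A b i.
Proof.
move=> d0 A0 zb [[a [beta [aP FE]]]]; rewrite (affdim_solutions zb) => dF.
(* The trivial inequality defines the whole solution set as a face; its dimension is too large for a
   facet. *)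
have aN0 : ~ (a = 0 /\ beta = 0).
  move=> [a0 beta0]; have FP : F = solutions A b.
    rewrite FE; apply/seteqP; split=> [x []//|x xP]; split=> //=.
    by rewrite a0 beta0 mul0mx mxE.
  by move: dF; rewrite FP (affdim_solutions zb); lia.
have [k [p [pF pind kE]]] := affdim_attained F.
have {kE} kd : k = d by lia.
subst k.
have pP l : solutions A b (p l) by have := pF l; rewrite FE => -[].
have pa l : (a *m p l) 0 0 = beta by have := pF l; rewrite FE => -[].
have [[i iP]|nt] := pselect (exists i, forall l, (A *m p l) i 0 = b i 0).
  have iP' l : (row i A *m p l) 0 0 = b i 0 by rewrite row_mulE.
  have [t [aE bE]] := hyperplane_unique pind (A0 i) iP' pa.
  have t0 : t != 0.
    by apply/eqP => t0; apply: aN0; rewrite aE bE t0 scale0r mul0r.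
  exists i; rewrite FE /row_face aE bE; congr (_ `&` _).
  apply/seteqP; split=> x /=; rewrite -scalemxAl; last first.
    by move=> <-; rewrite mxE.
  by rewrite mxE => /(mulfI t0).
(* The centroid is tight for a row only if all the points [p l] are. *)
pose c := d%:R^-1 *: \sum_l p l.
have d0R : 0 < (d%:R : R) by rewrite ltr0n.
have cb i : (A *m c) i 0 < b i 0.
  rewrite -scalemxAr mxE mulmx_sumr summxE mulrC ltr_pdivrMr//.
  have -> : b i 0 * d%:R = \sum_(l < d) b i 0.
    by rewrite sumr_const card_ord mulr_natr.
  rewrite lt_def ler_sum ?andbT; last by move=> l _; exact: pP.
  rewrite -subr_eq0 -sumrB; apply/eqP => s0; apply: nt; exists i => l.
  have bp j : true -> 0 <= b i 0 - (A *m p j) i 0 by rewrite subr_ge0 pP.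
  by have /eqP := psumr_eq0P bp s0 (i := l) isT; rewrite subr_eq0 => /eqP.
have ac : (a *m c) 0 0 = beta.
  rewrite -scalemxAr mxE mulmx_sumr summxE (eq_bigr (fun=> beta))//.
  by rewrite sumr_const card_ord -[beta *+ d]mulr_natl mulKf// gt_eqF.
have a0 := valid_tight_interior cb aP ac.
by case: aN0; split=> //; rewrite -ac a0 mul0mx mxE.
Qed.

Lemma card_facets (R : realType) (d m : nat) (A : 'M[R]_(m, d))
    (b : 'cV[R]_m) (z : 'cV[R]_d) :
  (0 < d)%N -> irredundant A b -> (forall i, (A *m z) i 0 < b i 0) ->
  ([set F | facet (solutions A b) F] #= `I_m)%card.
Proof.
move=> d0 irr zb.
have A0 i : row i A != 0.
  by apply: (irredundant_row_neq0 i irr (z := z)) => j; apply: ltW.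
have -> : [set F | facet (solutions A b) F] = row_face A b @` setT.
  apply/seteqP; split=> F /=.
    by move=> /(facet_row_face d0 A0 zb)[i ->]; exists i.
  move=> [i _ <-]; split; last first.
    by rewrite (affdim_row_face i irr zb) (affdim_solutions zb).
  exists (row i A), (b i 0); split=> // x /(_ i).
  by rewrite row_mulE.
(* The point where row [i] alone is tight lies on no other row face. *)
have inj : {in setT &, injective (row_face A b)}.
  move=> i j _ _ eF; have [w [wi wj]] := irredundant_tight i irr zb.
  apply: contrapT => /eqP; rewrite eq_sym => ji.
  have : row_face A b i w.
    split; last by rewrite /= row_mulE.
    by move=> l; have [->|/wj/ltW//] := eqVneq l i; rewrite wi.
  by rewrite eF => -[_] /=; rewrite row_mulE => e; have := wj _ ji; rewrite e ltxx.
by apply: card_eq_trans (inj_card_eq inj) _; rewrite card_eq_sym card_II.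
Qed.

(** * The unit box and the integer points of the cube's hull *)

Definition box (R : realType) (d : nat) : set 'cV[R]_d :=
  [set x | forall i, 0 <= x i 0 <= 1].
Arguments box : clear implicits.

Lemma embZ_inj (R : realType) (d : nat) : injective (@embZ R d).
Proof.
move=> x y /matrixP e; apply/matrixP => i j.
by have := e i j; rewrite !mxE => /intr_inj.
Qed.

Lemma cube_box (R : realType) (d : nat) (z : 'cV[int]_d) :
  box R d (embZ R z) <-> cube d z.
Proof.
split=> h i; have := h i; rewrite mxE.
  by rewrite ler0z lerz1; lia.
by move=> [] ->; rewrite ?lexx ?ler01.
Qed.

Lemma convex_box (R : realType) (d : nat) : convex_set (box R d).
Proof.
move=> x y l; rewrite !inE => xb yb i.
have -> : (convex.conv l (x : convex_lmodType 'cV[R]_d) y : 'cV[R]_d) i 0 =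
    l%:num * x i 0 + (1 - l%:num) * y i 0 by rewrite !mxE.
have /andP[x0 x1] := xb i; have /andP[y0 y1] := yb i.
have l0 : 0 <= l%:num by [].
have l1 : 0 <= 1 - l%:num :> R by rewrite subr_ge0.
apply/andP; split; first by rewrite addr_ge0// mulr_ge0.
have : 0 <= l%:num * (1 - x i 0) by rewrite mulr_ge0// subr_ge0.
have : 0 <= (1 - l%:num) * (1 - y i 0) by rewrite mulr_ge0// subr_ge0.
lra.
Qed.

(** The hull is contained in the convex set [box], whose integer points are the 0/1 vectors. *)
Lemma conv_cube_Zlattice (R : realType) (d : nat) :
  Defs.conv (@embZ R d @` cube d) `&` Zlattice R d = @embZ R d @` cube d.
Proof.
apply/seteqP; split=> [x [xconv [z _ zx]]|_ [z zc <-]]; last first.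
  by split; [apply: sub_gen_smallest; exists z|exists z].
have sub : @embZ R d @` cube d `<=` box R d.
  by move=> _ [w wc <-]; apply/cube_box.
exists z => //; apply/(cube_box R); rewrite zx.
exact: (smallest_sub (@convex_box R d) sub xconv).
Qed.

Lemma relaxation_cubeP (R : realType) (d : nat) (P : set 'cV[R]_d)
    (z : 'cV[int]_d) :
  relaxation (cube d) P -> P (embZ R z) <-> cube d z.
Proof.
move=> [_ PE]; rewrite conv_cube_Zlattice in PE; split=> [zP|zc].
  have : (P `&` Zlattice R d) (embZ R z) by split=> //; exists z.
  by rewrite PE => -[w wc /embZ_inj <-].
by have : (@embZ R d @` cube d) (embZ R z); [exists z|rewrite -PE => -[]].
Qed.

Definition center (R : realType) (d : nat) : 'cV[R]_d := const_mx 2^-1.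
Arguments center : clear implicits.

(** The vertex has a 1 exactly where [a] is positive. Compared with the center, coordinate [i] gains
    half the absolute value of [a 0 i], whence the strictness. *)
Lemma cube_maximizer (R : realType) (d : nat) (a : 'rV[R]_d) :
  exists z : 'cV[int]_d, [/\ cube d z,
    forall x, box R d x -> (a *m x) 0 0 <= (a *m embZ R z) 0 0 &
    a != 0 -> (a *m center R d) 0 0 < (a *m embZ R z) 0 0].
Proof.
exists (\col_i (if 0 < a 0 i then 1 else 0)); split=> [i|x xb|a0].
- by rewrite mxE; case: ifP => _; [right|left].
- rewrite !mxE; apply: ler_sum => i _; rewrite !mxE.
  have /andP[x0 x1] := xb i; case: (ltP 0 (a 0 i)) => ai; last first.
    by rewrite mulr0z mulr0 mulr_le0_ge0.
  by rewrite mulr1z mulr1 ler_piMr// ltW.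
have /rV0Pn[i ai] := a0.
have half : 0 < 2^-1 :> R by rewrite invr_gt0.
rewrite /center !mxE (bigD1 i)//= [ltRHS](bigD1 i)//= !mxE; apply: ltr_leD.
  case: (ltP 0 (a 0 i)) => ai0; first by rewrite mulr1z mulr1; lra.
  by rewrite mulr0z mulr0 pmulr_llt0// lt_neqAle ai.
apply: ler_sum => j _; rewrite !mxE; case: (ltP 0 (a 0 j)) => aj.
  by rewrite mulr1z mulr1; lra.
by rewrite mulr0z mulr0 pmulr_lle0.
Qed.

(** * Lower bound on the number of rows of a relaxation *)

(** Each row attains its maximum over the box at a vertex of the cube, and that vertex satisfies the
    system. *)
Lemma relaxation_box (R : realType) (d m : nat) (A : 'M[R]_(m, d))
    (b : 'cV[R]_m) :
  relaxation (cube d) (solutions A b) -> box R d `<=` solutions A b.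
Proof.
move=> rel x xb i.
have [z [/(relaxation_cubeP _ rel) zP zx _]] := cube_maximizer (row i A).
by rewrite -(row_mulE A x); apply: le_trans (zx _ xb) _; rewrite row_mulE; apply: zP.
Qed.

Lemma relaxation_center (R : realType) (d m : nat) (A : 'M[R]_(m, d))
    (b : 'cV[R]_m) (i : 'I_m) :
  relaxation (cube d) (solutions A b) -> row i A != 0 ->
  (A *m center R d) i 0 < b i 0.
Proof.
move=> rel Ai.
have [z [/(relaxation_cubeP _ rel) zP _ zc]] := cube_maximizer (row i A).
by rewrite -row_mulE; apply: lt_le_trans (zc Ai) _; rewrite row_mulE; apply: zP.
Qed.

(** If the rank is below [d], a kernel vector works. Otherwise [A] is square and invertible, and
    [A u] can be prescribed to have all entries -1. *)
Lemma recession_direction (R : realType) (d m : nat) (A : 'M[R]_(m, d)) :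
  (0 < d)%N -> (m <= d)%N ->
  exists2 u : 'cV[R]_d, u != 0 & forall i, (A *m u) i 0 <= 0.
Proof.
move=> d0 md; have [rA|rA] := ltnP (\rank A) d.
  have K0 : kermx A^T != 0 by rewrite -mxrank_eq0 mxrank_ker mxrank_tr; lia.
  exists (nz_row (kermx A^T))^T => [|i]; first by rewrite trmx_eq0 nz_row_eq0.
  have /sub_kermxP : (nz_row (kermx A^T) <= kermx A^T)%MS by apply: nz_row_sub.
  move=> /(congr1 trmx); rewrite trmx_mul trmxK => ->.
  by rewrite trmx0 mxE.
have {md} mE : m = d by have := rank_leq_row A; lia.
subst m; have Au : A \in unitmx.
  by rewrite -row_free_unit /row_free eqn_leq rank_leq_row.
have AE : A *m (invmx A *m const_mx (-1)) = const_mx (-1) :> 'cV[R]_d.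
  by rewrite mulmxA mulmxV// mul1mx.
exists (invmx A *m const_mx (-1)) => [|i]; last by rewrite AE mxE lerN10.
apply/eqP => u0; move: AE; rewrite u0 mulmx0 => /colP/(_ (Ordinal d0)).
by rewrite !mxE; lra.
Qed.

Lemma relaxation_cube_rows (R : realType) (d m : nat) (A : 'M[R]_(m, d))
    (b : 'cV[R]_m) :
  (0 < d)%N -> relaxation (cube d) (solutions A b) -> (d < m)%N.
Proof.
move=> d0 rel; rewrite ltnNge; apply/negP => md.
have [u u0 Au] := recession_direction A d0 md.
have /cV0Pn[i ui] := u0.
(* This scaling makes coordinate [i] of [t *: u] equal to 2 or -2, an integer other than 0 and 1. *)
pose t := 2 / `|u i 0|.
have t0 : 0 <= t by rewrite divr_ge0.
(* Rounding up puts [z] in the box translated by [t *: u], and that translate lies inside the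
   relaxation. *)
pose z : 'cV[int]_d := \col_j Num.ceil (t * u j 0).
have zbox : box R d (embZ R z - t *: u).
  move=> j; rewrite !mxE; have := ceil_itv (t * u j 0).
  by rewrite intrB => /andP[? ?]; apply/andP; split; lra.
have /(relaxation_cubeP _ rel)/(_ i) : solutions A b (embZ R z).
  move=> k; rewrite -[embZ R z](subrK (t *: u)) mulmxDr -scalemxAr mxE.
  rewrite [X in _ + X]mxE.
  have := relaxation_box rel zbox k.
  have : t * (A *m u) k 0 <= 0 by rewrite mulr_ge0_le0.
  lra.
have tu : t * u i 0 = 2 \/ t * u i 0 = - 2.
  rewrite /t; case: (ltrgt0P (u i 0)) ui => // ui _; [left|right].
    by rewrite divfK// gt_eqF.
  by rewrite invrN mulrN mulNr divfK// lt_eqF.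
rewrite mxE; have : Num.ceil (t * u i 0) = 2 \/ Num.ceil (t * u i 0) = - 2.
  by case: tu => ->; [left; exact: (intrKceil 2)|right; exact: (intrKceil (- 2))].
lia.
Qed.

(** * Upper bound: a simplex whose integer points are the 0/1 vectors *)

Definition tail (R : realType) (d k : nat) (x : 'cV[R]_d) : R :=
  \sum_(j < d | (k <= j)%N) 2^-1 ^+ j * x j 0.

(** Row 0 encodes [0 <= tail 0 x], and row [lift ord0 k] encodes [x k 0 <= 1 + tail k.+1 x]. *)
Definition simplex_mx (R : realType) (d : nat) : 'M[R]_(d.+1, d) :=
  \matrix_(i, j) (if unlift ord0 i is Some k
    then (j == k)%:R - (if (k < j)%N then 2^-1 ^+ j else 0)
    else - 2^-1 ^+ j).

Definition simplex_rhs (R : realType) (d : nat) : 'cV[R]_d.+1 :=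
  \col_i (if unlift ord0 i is Some _ then 1 else 0).

Lemma simplexP (R : realType) (d : nat) (x : 'cV[R]_d) :
  solutions (simplex_mx R d) (simplex_rhs R d) x <->
  0 <= tail 0 x /\ forall k : 'I_d, x k 0 <= 1 + tail k.+1 x.
Proof.
have row0 : (simplex_mx R d *m x) ord0 0 = - tail 0 x.
  rewrite mxE /tail -sumrN; apply: eq_bigr => j _.
  by rewrite mxE unlift_none mulNr.
have rowS k : (simplex_mx R d *m x) (lift ord0 k) 0 = x k 0 - tail k.+1 x.
  rewrite mxE /tail [in RHS]big_mkcond /=.
  rewrite (eq_bigr (fun j => (if j == k then x j 0 else 0) -
      (if (k < j)%N then 2^-1 ^+ j * x j 0 else 0))) => [|j _].
    by rewrite sumrB -big_mkcond big_pred1_eq.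
  rewrite mxE liftK mulrBl; congr (_ - _).
    by case: eqP; rewrite ?mul1r ?mul0r.
  by case: ifP; rewrite ?mul0r.
split=> [xs|[x0 xk] i].
  split=> [|k].
    by have := xs ord0; rewrite row0 mxE unlift_none oppr_le0.
  by have := xs (lift ord0 k); rewrite rowS mxE liftK; lra.
case: (unliftP ord0 i) => [k ->|->].
  by rewrite rowS mxE liftK lerBlDr xk.
by rewrite row0 mxE unlift_none oppr_le0.
Qed.

Lemma tail_rec (R : realType) (d : nat) (k : 'I_d) (x : 'cV[R]_d) :
  tail k x = 2^-1 ^+ k * x k 0 + tail k.+1 x.
Proof.
rewrite /tail (bigD1 k)//=; congr (_ + _); apply: eq_bigl => j.
by rewrite ltn_neqAle andbC eq_sym.
Qed.

(** The bound is the full geometric series of ratio 1/2 starting at index [k]; it is strict because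
    the sum is finite. *)
Lemma tail_lt (R : realType) (d : nat) (x : 'cV[R]_d) (k : nat) :
  (forall j : 'I_d, (k <= j)%N -> x j 0 <= 1) -> tail k x < 2 * 2^-1 ^+ k.
Proof.
have pos n : 0 < 2^-1 ^+ n :> R by rewrite exprn_gt0// invr_gt0.
move: {2}(d - k)%N (leqnn (d - k)) => n; elim: n k => [|n IH] k dk x1.
  rewrite /tail big_pred0 ?mulr_gt0// => j.
  by have := ltn_ord j; lia.
have [dk'|kd] := leqP d k.
  rewrite /tail big_pred0 ?mulr_gt0// => j.
  by have := ltn_ord j; lia.
rewrite -[k]/(nat_of_ord (Ordinal kd)) tail_rec /=.
have := IH k.+1 ltac:(lia) (fun j kj => x1 j (ltnW kj)).
rewrite exprS; have := x1 (Ordinal kd) (leqnn k); have := pos k; nra.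
Qed.

Lemma simplex_upper (R : realType) (d : nat) (z : 'cV[int]_d) :
  solutions (simplex_mx R d) (simplex_rhs R d) (embZ R z) ->
  forall k, z k 0 <= 1.
Proof.
move=> /simplexP[_ zk].
(* Downward induction on [k], through a bound [n] on [d - k]: if later coordinates are at most 1,
   the tail after [k] is below [2^-k <= 1], so [z k 0 < 2]. *)
suff h n (k : 'I_d) : (d - k <= n)%N -> z k 0 <= 1 by move=> k; apply: (h d); lia.
elim: n k => [|n IH] k kn; first by have := ltn_ord k; lia.
have := zk k; have : tail k.+1 (embZ R z) < 2 * 2^-1 ^+ k.+1.
  by apply: tail_lt => j kj; rewrite mxE lerz1; apply: IH; lia.
have : 2^-1 ^+ k <= 1 :> R by rewrite exprn_ile1 ?invr_ge0// invf_le1// ler1n.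
rewrite exprS mxE => h1 h2 h3.
have : (z k 0)%:~R < 2%:~R :> R by lra.
by rewrite ltr_int; lia.
Qed.

Lemma simplex_cube (R : realType) (d : nat) (z : 'cV[int]_d) :
  solutions (simplex_mx R d) (simplex_rhs R d) (embZ R z) <-> cube d z.
Proof.
have pos n : 0 < 2^-1 ^+ n :> R by rewrite exprn_gt0// invr_gt0.
split=> [zs|zc]; last first.
  have tail0 k : 0 <= tail k (embZ R z).
    apply: sumr_ge0 => j _; apply: mulr_ge0; first exact: ltW.
    by have /andP[] := (cube_box R z).2 zc j.
  apply/simplexP; split=> // k.
  have /andP[_] := (cube_box R z).2 zc k; have := tail0 k.+1; lra.
have up := simplex_upper zs; have /simplexP[z0 zk] := zs.
(* The tail after [k] is below [2^-k], so a nonnegative tail at [k] forces [z k 0 > -1]. The next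
   tail is then nonnegative: it equals the current one if [z k 0 = 0], and constraint [k] says so if
   [z k 0 = 1]. *)
have step (k : 'I_d) : 0 <= tail k (embZ R z) ->
    (z k 0 = 0 \/ z k 0 = 1) /\ 0 <= tail k.+1 (embZ R z).
  rewrite tail_rec => tk.
  have lt : tail k.+1 (embZ R z) < 2^-1 ^+ k.
    have : tail k.+1 (embZ R z) < 2 * 2^-1 ^+ k.+1.
      by apply: tail_lt => j _; rewrite mxE lerz1.
    by rewrite exprS mulVKf.
  have zk01 : z k 0 = 0 \/ z k 0 = 1.
    have : (-1)%:~R < (z k 0)%:~R :> R.
      rewrite mxE in tk; have := pos k; nra.
    by rewrite ltr_int; have := up k; lia.
  split=> //; have := zk k; case: zk01 tk => e; rewrite mxE e.
    by rewrite mulr0z mulr0 add0r.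
  by rewrite mulr1z lerDl.
have tail0 k : (k <= d)%N -> 0 <= tail k (embZ R z).
  elim: k => [//|k IH] kd.
  by have [] := step (Ordinal kd) (IH (ltnW kd)).
by move=> k; have [] := step k (tail0 _ (ltnW (ltn_ord k))).
Qed.

Lemma simplex_relaxation (R : realType) (d : nat) :
  relaxation (cube d) (solutions (simplex_mx R d) (simplex_rhs R d)).
Proof.
split; first by exists d.+1, (simplex_mx R d), (simplex_rhs R d).
rewrite conv_cube_Zlattice; apply/seteqP; split=> [x [xs [z _ zx]]|_ [z zc <-]].
  by exists z => //; apply/(simplex_cube R); rewrite zx.
by split; [apply/simplex_cube|exists z].
Qed.

(** * Counting facets and computing the relaxation complexity *)

(** An irredundant subsystem describes the same set. Its rows are nonzero, so the center of the box
    is strictly interior and the facets are counted by its [m'] rows. *)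
Lemma relaxation_cube_facets (R : realType) (d m : nat) (A : 'M[R]_(m, d))
    (b : 'cV[R]_m) :
  (0 < d)%N -> relaxation (cube d) (solutions A b) ->
  exists m', [/\ (d < m')%N, (m' <= m)%N &
    ([set F | facet (solutions A b) F] #= `I_m')%card].
Proof.
move=> d0 rel; have [m' [A' [b' [m'm sE irr]]]] := irredundant_exists A b.
rewrite -sE in rel *; exists m'; split=> //; first exact: relaxation_cube_rows rel.
apply: card_facets => // i; apply: relaxation_center => //.
apply: (irredundant_row_neq0 i irr (z := center R d)).
apply: relaxation_box => // j; rewrite mxE invr_ge0 ler0n/= invf_le1//.
by rewrite ler1n.
Qed.

Theorem theorem2 (R : realType) (d : nat) (hd : (1 <= d)%N) :
  rc R (cube d) = Some d.+1.
Proof.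
have has : has_relaxation_with R (cube d) d.+1.
  exists (solutions (simplex_mx R d) (simplex_rhs R d)).
  split; first exact: simplex_relaxation.
  (* The simplex is given by [d.+1] rows, so the two bounds on [m] coincide. *)
  have [m [dm md]] := relaxation_cube_facets hd (simplex_relaxation R d).
  by have -> : m = d.+1 by apply/eqP; rewrite eqn_leq md.
have lower n : has_relaxation_with R (cube d) n -> (d < n)%N.
  move=> [P [rel cP]]; have [m [A [b PE]]] := rel.1.
  rewrite PE -/(solutions A b) in rel cP.
  have [m' [dm' _ cm']] := relaxation_cube_facets hd rel.
  suff -> : n = m' by [].
  by apply/card_eq_II; apply: card_eq_trans cm'; rewrite card_eq_sym.
rewrite /rc; case: pselect => [h|[]]; last by exists d.+1; apply/asboolP.
congr Some; case: ex_minnP => n /asboolP/lower dn /(_ d.+1 (asboolT has)) nd.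
by apply/eqP; rewrite eqn_leq nd.
Qed.
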